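(* Let $\Lambda=\{\alpha_1,\ldots,\alpha_n\}$ and $\Omega=\{\beta_1,\ldots,\beta_m\}$ be two (not necessarily disjoint) finite sets, each consisting of distinct quaternions, with $\Omega\cap\mathbb{R}=\emptyset$, and let $c_1,\ldots,c_n,d_1,\ldots,d_m\in\mathbb{H}$. Assume that no three (distinct) elements of the set $\Lambda\cup\Omega$ are equivalent. Then there is a polynomial $f\in\mathbb{H}[z]$ satisfying $$f^{\mathbf{e}_\ell}(\alpha_i)=c_i\quad (i=1,\ldots,n),\qquad f^{\mathbf{e}_r}(\beta_j)=d_j\quad (j=1,\ldots,m)$$ if and only if $\overline{\alpha}_i(c_i-d_j)=(c_i-d_j)\beta_j$ for each pair $(\alpha_i,\beta_j)\in\Lambda\times\Omega$ of equivalent nodes $\alpha_i\sim\beta_j$.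
   Context: $\mathbb{H}$ is the skew field of real quaternions, $\overline{\alpha}$ is the quaternionic conjugate. $\mathbb{H}[z]$ is the ring of polynomials in one formal variable $z$ that commutes with the quaternionic coefficients. For $f(z)=\sum_{k} z^k f_k\in\mathbb{H}[z]$ and $\alpha\in\mathbb{H}$, the left and right evaluations are $f^{\mathbf{e}_\ell}(\alpha)=\sum_k \alpha^k f_k$ and $f^{\mathbf{e}_r}(\alpha)=\sum_k f_k\alpha^k$. Two quaternions are equivalent, $\alpha\sim\beta$, if $\alpha=h^{-1}\beta h$ for some nonzero $h\in\mathbb{H}$. *)

(* Defs.v *)
From HB Require Import structures.
From mathcomp Require Import all_boot all_order all_algebra.
From mathcomp Require Import ring lra.

Set Implicit Arguments.
Unset Strict Implicit.
Unset Printing Implicit Defensive.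

Import Order.TTheory GRing.Theory Num.Theory.
Local Open Scope ring_scope.

(* Quat a b c d is a + b i + c j + d k, see quatE below. *)
Record quat (R : Type) := Quat { qre : R; qim1 : R; qim2 : R; qim3 : R }.

Lemma quat_ext (R : Type) (x y : quat R) :
  qre x = qre y -> qim1 x = qim1 y -> qim2 x = qim2 y -> qim3 x = qim3 y ->
  x = y.
Proof. by case: x y => [? ? ? ?] [? ? ? ?] /= -> -> -> ->. Qed.

Section QuatChoice.
Variable R : choiceType.

Definition quat_tuple (x : quat R) : R * R * R * R :=
  (qre x, qim1 x, qim2 x, qim3 x).

Definition tuple_quat (t : R * R * R * R) : quat R :=
  let: (a, b, c, d) := t in Quat a b c d.

Lemma quat_tupleK : cancel quat_tuple tuple_quat.
Proof. by case. Qed.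

HB.instance Definition _ := Choice.copy (quat R) (can_type quat_tupleK).
End QuatChoice.

Section QuatField.
Variable R : realFieldType.
Implicit Types (x y z : quat R) (r : R).

Definition qreal r : quat R := Quat r 0 0 0.
Definition qI : quat R := Quat 0 1 0 0.
Definition qJ : quat R := Quat 0 0 1 0.
Definition qK : quat R := Quat 0 0 0 1.

Definition qadd x y : quat R :=
  Quat (qre x + qre y) (qim1 x + qim1 y) (qim2 x + qim2 y) (qim3 x + qim3 y).

Definition qopp x : quat R :=
  Quat (- qre x) (- qim1 x) (- qim2 x) (- qim3 x).

Definition qmul x y : quat R :=
  let: Quat a b c d := x in
  let: Quat a' b' c' d' := y in
  Quat (a * a' - b * b' - c * c' - d * d')
       (a * b' + b * a' + c * d' - d * c')
       (a * c' - b * d' + c * a' + d * b')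
       (a * d' + b * c' - c * b' + d * a').

Definition qconj x : quat R :=
  Quat (qre x) (- qim1 x) (- qim2 x) (- qim3 x).

Definition qnorm2 x : R :=
  qre x ^+ 2 + qim1 x ^+ 2 + qim2 x ^+ 2 + qim3 x ^+ 2.

Definition qinv x : quat R :=
  Quat (qre x / qnorm2 x) (- qim1 x / qnorm2 x)
       (- qim2 x / qnorm2 x) (- qim3 x / qnorm2 x).

Fact qaddA : associative qadd.
Proof. by move=> x y z; apply: quat_ext; rewrite /= addrA. Qed.
Fact qaddC : commutative qadd.
Proof. by move=> x y; apply: quat_ext; rewrite /= addrC. Qed.
Fact qadd0 : left_id (qreal 0) qadd.
Proof. by move=> x; apply: quat_ext; rewrite /= add0r. Qed.
Fact qaddN : left_inverse (qreal 0) qopp qadd.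
Proof. by move=> x; apply: quat_ext; rewrite /= addNr. Qed.

HB.instance Definition _ :=
  GRing.isZmodule.Build (quat R) qaddA qaddC qadd0 qaddN.

Fact qmulA : associative qmul.
Proof.
by move=> [? ? ? ?] [? ? ? ?] [? ? ? ?]; apply: quat_ext => /=; ring.
Qed.
Fact qmul1l : left_id (qreal 1) qmul.
Proof. by move=> [? ? ? ?]; apply: quat_ext => /=; ring. Qed.
Fact qmul1r : right_id (qreal 1) qmul.
Proof. by move=> [? ? ? ?]; apply: quat_ext => /=; ring. Qed.
Fact qmulDl : left_distributive qmul qadd.
Proof.
by move=> [? ? ? ?] [? ? ? ?] [? ? ? ?]; apply: quat_ext => /=; ring.
Qed.
Fact qmulDr : right_distributive qmul qadd.
Proof.
by move=> [? ? ? ?] [? ? ? ?] [? ? ? ?]; apply: quat_ext => /=; ring.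
Qed.
Fact qone_neq0 : qreal 1 != 0.
Proof. by apply/eqP => -[] /eqP; rewrite oner_eq0. Qed.

HB.instance Definition _ := GRing.Zmodule_isNzRing.Build (quat R)
  qmulA qmul1l qmul1r qmulDl qmulDr qone_neq0.

Lemma qnorm2_eq0 x : (qnorm2 x == 0) = (x == 0).
Proof.
apply/eqP/eqP => [|->]; last by rewrite /qnorm2 /= !expr0n /= !addr0.
case: x => a b c d; rewrite /qnorm2 /= => h.
have ha := sqr_ge0 a; have hb := sqr_ge0 b.
have hc := sqr_ge0 c; have hd := sqr_ge0 d.
by apply: quat_ext => /=; apply/eqP; rewrite -sqrf_eq0; apply/eqP; lra.
Qed.

Fact qmulVx : {in [pred x : quat R | x != 0], left_inverse 1 qinv *%R}.
Proof.
move=> x; rewrite inE -qnorm2_eq0; case: x => a b c d h.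
by apply: quat_ext; rewrite /= /qnorm2 /= in h *; field.
Qed.
Fact qmulxV : {in [pred x : quat R | x != 0], right_inverse 1 qinv *%R}.
Proof.
move=> x; rewrite inE -qnorm2_eq0; case: x => a b c d h.
by apply: quat_ext; rewrite /= /qnorm2 /= in h *; field.
Qed.
Fact qunitP x y : y * x = 1 /\ x * y = 1 -> x \in [pred x : quat R | x != 0].
Proof.
case=> yx1 _; rewrite inE; apply/eqP => x0.
by have := oner_neq0 (quat R); rewrite -yx1 x0 mulr0 eqxx.
Qed.
Fact qinv_out : {in [predC [pred x : quat R | x != 0]], qinv =1 id}.
Proof.
move=> x; rewrite !inE negbK => /eqP ->.
by apply: quat_ext; rewrite /= ?oppr0 mul0r.
Qed.

HB.instance Definition _ := GRing.NzRing_hasMulInverse.Build (quat R)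
  qmulVx qmulxV qunitP qinv_out.

Lemma qunitE x : (x \is a GRing.unit) = (x != 0).
Proof. by []. Qed.

Lemma quatE a b c d :
  Quat a b c d = qreal a + qreal b * qI + qreal c * qJ + qreal d * qK.
Proof. by apply: quat_ext => /=; ring. Qed.

Lemma qI2 : qI ^+ 2 = -1.
Proof. by apply: quat_ext => /=; ring. Qed.
Lemma qJ2 : qJ ^+ 2 = -1.
Proof. by apply: quat_ext => /=; ring. Qed.
Lemma qK2 : qK ^+ 2 = -1.
Proof. by apply: quat_ext => /=; ring. Qed.
Lemma qIJK : qI * qJ * qK = -1.
Proof. by apply: quat_ext => /=; ring. Qed.

Definition qequiv x y : Prop := exists2 h : quat R, h != 0 & x = h^-1 * y * h.

End QuatField.

(* In MathComp's {poly A} the indeterminate commutes with the coefficients, and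
   horner places coefficients on the left: f.[x] = \sum_k f`_k * x ^+ k (lemma
   horner_coef), so f.[x] is the right evaluation. *)
Definition left_eval (A : nzRingType) (f : {poly A}) (x : A) : A :=
  \sum_(k < size f) x ^+ k * f`_k.

(* Main.v *)
From HB Require Import structures.
Require Import Defs.
From mathcomp Require Import all_boot all_order all_algebra.
From mathcomp Require Import reals ring lra.

Import GRing.Theory.
Local Open Scope ring_scope.

(** The equivalence class of a quaternion x is determined by its trace and its
norm, that is, by its characteristic polynomial z^2 - 2 Re(x) z + |x|^2
([qequiv_qclass], [qclass_qequiv]), a real and hence central polynomial which
vanishes exactly on that class.

Necessity. If x ~ y, then e = f_l(x) - f_r(y) satisfies conj(x) e = e y, for
every f. Replacing f by f z + a replaces e by x e + (x b - b y) with
b = f_r(y); the relation is stable under e |-> x e, and it holds for x b - b y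
because x and y have the same characteristic polynomial ([twisted_eval]).

Sufficiency, one class at a time. A linear polynomial p z + q is enough on a
single class. Two nodes of the same side determine p and q. They also force
the value at any node of the opposite side: the discrepancy e at that node
satisfies two relations, for instance conj(x) e = e y and conj(x') e = e y,
whence conj(x - x') e = 0 and e = 0 ([twisted2_eq0], [twisted2r_eq0]). With one
node x on the left and one node y on the right, one has to solve the Sylvester
equation x p - p y = e, where conj(x) e = e y; then p = (x - conj(x))^-1 e is a
solution ([mixed_interp]). As a class contains at most two distinct nodes, these
cases, and the trivial ones with at most one condition, exhaust the
possibilities ([interpolates_class]).

Gluing. For inequivalent x and y there is a real polynomial equal to 1 on the
class of x and to 0 on that of y ([separate2]). Both evaluations are
multiplicative with respect to real factors, so the local solutions are
combined as in the Chinese remainder theorem ([interpolates_seq]). *)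

(** * Left evaluation *)

Section LeftEval.
Context {A : nzRingType}.
Implicit Types (f g : {poly A}) (a x : A).

Lemma left_eval_wide (N : nat) f x :
  (size f <= N)%N -> left_eval f x = \sum_(k < N) x ^+ k * f`_k.
Proof.
move=> szf; rewrite /left_eval (big_ord_widen N (fun k => x ^+ k * f`_k)) //.
rewrite big_mkcond /=; apply: eq_bigr => k _; case: ltnP => // szk.
by rewrite nth_default ?mulr0.
Qed.

Lemma left_evalD f g x : left_eval (f + g) x = left_eval f x + left_eval g x.
Proof.
pose N := maxn (size f) (size g).
rewrite !(left_eval_wide N) ?size_polyD ?leq_maxl ?leq_maxr //.
by rewrite -big_split /=; apply: eq_bigr => k _; rewrite coefD mulrDr.
Qed.

Lemma left_evalC a x : left_eval a%:P x = a.
Proof.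
by rewrite (left_eval_wide 1) ?size_polyC_leq1 // big_ord1 coefC mul1r.
Qed.

Lemma left_evalMX f x : left_eval (f * 'X) x = x * left_eval f x.
Proof.
have szfX : (size (f * 'X)%R <= (size f).+1)%N.
  by apply: leq_trans (size_polyMleq _ _) _; rewrite size_polyX addn2.
rewrite (left_eval_wide _ _ _ szfX) big_ord_recl coefMX mulr0 add0r.
rewrite /left_eval mulr_sumr; apply: eq_bigr => k _.
by rewrite coefMX /= exprS mulrA.
Qed.

Lemma left_evalMXaddC f a x :
  left_eval (f * 'X + a%:P) x = x * left_eval f x + a.
Proof. by rewrite left_evalD left_evalMX left_evalC. Qed.

Lemma left_evalMC f a x : left_eval (f * a%:P) x = left_eval f x * a.
Proof.
pose N := maxn (size (f * a%:P)) (size f).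
rewrite !(left_eval_wide N) ?leq_maxl ?leq_maxr // mulr_suml.
by apply: eq_bigr => k _; rewrite coefMC mulrA.
Qed.

Lemma left_eval_linear p q x : left_eval (p%:P * 'X + q%:P) x = x * p + q.
Proof. by rewrite left_evalMXaddC left_evalC. Qed.

Lemma horner_linear (p q x : A) : (p%:P * 'X + q%:P).[x] = p * x + q.
Proof. by rewrite hornerMXaddC hornerC. Qed.

End LeftEval.

Section Quaternions.
Context {R : realFieldType}.
Implicit Types (x y h e p q : quat R) (r : R).

(** * Quaternion arithmetic *)

Fact qreal_is_zmod_morphism : zmod_morphism (@qreal R).
Proof. by move=> r s; apply: quat_ext => /=; ring. Qed.

Fact qreal_is_monoid_morphism : monoid_morphism (@qreal R).
Proof. by split=> // r s; apply: quat_ext => /=; ring. Qed.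

HB.instance Definition _ :=
  GRing.isZmodMorphism.Build R (quat R) (@qreal R) qreal_is_zmod_morphism.
HB.instance Definition _ :=
  GRing.isMonoidMorphism.Build R (quat R) (@qreal R) qreal_is_monoid_morphism.

Lemma qrealC r x : GRing.comm x (qreal r).
Proof. by case: x => a b c d; apply: quat_ext => /=; ring. Qed.

Lemma qcentral_real x : GRing.comm x (qI R) -> GRing.comm x (qJ R) ->
  exists r, x = qreal r.
Proof.
case: x => a b c d [] /= e1 e2 e3 e4 [] /= f1 f2 f3 f4.
by exists a; apply: quat_ext => /=; lra.
Qed.

Lemma qmulxC x : x * qconj x = qreal (qnorm2 x).
Proof.
by case: x => a b c d; apply: quat_ext => /=; rewrite /qnorm2 /=; ring.
Qed.

Lemma qmulCx x : qconj x * x = qreal (qnorm2 x).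
Proof.
by case: x => a b c d; apply: quat_ext => /=; rewrite /qnorm2 /=; ring.
Qed.

Lemma qnorm2M x y : qnorm2 (x * y) = qnorm2 x * qnorm2 y.
Proof. by case: x y => a b c d [a' b' c' d']; rewrite /qnorm2 /=; ring. Qed.

Lemma qre_mulC x y : qre (x * y) = qre (y * x).
Proof. by case: x y => a b c d [a' b' c' d'] /=; ring. Qed.

Lemma qconj_inj : injective (@qconj R).
Proof.
apply: can_inj (@qconj R) _ => -[a b c d].
by apply: quat_ext; rewrite /= ?opprK.
Qed.

Lemma qconj_trace x : qconj x = qreal (qre x *+ 2) - x.
Proof. by case: x => a b c d; apply: quat_ext => /=; ring. Qed.

Lemma qadd_conj x : x + qconj x = qreal (qre x *+ 2).
Proof. by rewrite qconj_trace addrC subrK. Qed.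

Lemma qsqr_norm2 x : x * x + qreal (qnorm2 x) = x * qreal (qre x *+ 2).
Proof. by rewrite -qmulxC -mulrDr qadd_conj. Qed.

Lemma qconj_eq_real x : qconj x = x -> x = qreal (qre x).
Proof. by case: x => a b c d [] /= *; apply: quat_ext => /=; lra. Qed.

Lemma quat_mul_eq0l x y : x != 0 -> x * y = 0 -> y = 0.
Proof.
move=> x0; have ux : x \is a GRing.unit by rewrite qunitE.
by move/(congr1 (fun z => x^-1 * z)); rewrite mulKr // mulr0.
Qed.

Lemma quat_mul_eq0r x y : y != 0 -> x * y = 0 -> x = 0.
Proof.
move=> y0; have uy : y \is a GRing.unit by rewrite qunitE.
by move/(congr1 (fun z => z * y^-1)); rewrite mulrK // mul0r.
Qed.

(** * Equivalence classes *)

Definition qclass x : R * R := (qre x, qnorm2 x).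

Lemma qclass_conj x : qclass (qconj x) = qclass x.
Proof. by case: x => *; congr pair; rewrite /qnorm2 /= !sqrrN. Qed.

Lemma qequiv_qclass x y : qequiv x y -> qclass x = qclass y.
Proof.
case=> h h0 ->; have uh : h \is a GRing.unit by rewrite qunitE.
congr pair; first by rewrite qre_mulC mulrA mulrV // mul1r.
have nh : qnorm2 h != 0 by rewrite qnorm2_eq0.
apply: (mulfI nh); rewrite -qnorm2M -mulrA mulVKr //.
by rewrite qnorm2M mulrC.
Qed.

(** After expansion, this is y w (x + conj(x)) = (y^2 + |x|^2) w, and both sides
equal 2 Re(y) y w. *)
Lemma qclass_intertwine x y w : qclass x = qclass y ->
  (y * w - w * qconj x) * x = y * (y * w - w * qconj x).
Proof.
case=> re_xy n_xy; rewrite mulrBl mulrBr; apply/eqP.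
rewrite subr_eq addrAC eq_sym subr_eq; apply/eqP.
rewrite -[w * _ * x]mulrA qmulCx n_xy qrealC !mulrA -mulrDl qsqr_norm2.
by rewrite -mulrDr qadd_conj re_xy -!mulrA qrealC.
Qed.

(** A conjugating element is found among the y w - w conj(x) with w = 1, i, j:
if all three vanish, then y = conj(x) is central, so it is real and equal to x. *)
Lemma qclass_qequiv x y : qclass x = qclass y -> qequiv x y.
Proof.
move=> cxy.
have equiv_of h : h * x = y * h -> h != 0 -> qequiv x y.
  move=> hxyh h0; exists h => //.
  by rewrite -mulrA -hxyh mulKr // qunitE.
have [/eqP h0|] := eqVneq (y * 1 - 1 * qconj x) 0; last first.
  exact/equiv_of/qclass_intertwine.
move: h0; rewrite mulr1 mul1r subr_eq0 => /eqP yE.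
have [/eqP hI|] := eqVneq (y * qI R - qI R * qconj x) 0; last first.
  exact/equiv_of/qclass_intertwine.
have [/eqP hJ|] := eqVneq (y * qJ R - qJ R * qconj x) 0; last first.
  exact/equiv_of/qclass_intertwine.
move: hI hJ; rewrite !subr_eq0 -yE => /eqP hI /eqP hJ.
have [r yr] := @qcentral_real y hI hJ.
apply: (equiv_of 1); last exact: oner_neq0.
rewrite mulr1 mul1r; apply: qconj_inj; rewrite -yE yr.
by apply: quat_ext; rewrite /= ?oppr0.
Qed.

(** * The compatibility relation between left and right values *)

Definition twisted x y e := qconj x * e = e * y.

Lemma twistedD x y e e' :
  twisted x y e -> twisted x y e' -> twisted x y (e + e').
Proof. by rewrite /twisted mulrDl mulrDr => -> ->. Qed.

Lemma twistedB x y e e' :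
  twisted x y e -> twisted x y e' -> twisted x y (e - e').
Proof. by rewrite /twisted mulrBl mulrBr => -> ->. Qed.

Lemma twisted_sylvester x y b : qclass x = qclass y ->
  twisted x y (x * b - b * y).
Proof.
case=> re_xy n_xy; rewrite /twisted mulrBl mulrBr !mulrA qmulCx.
(* The goal becomes |x|^2 b + b y^2 = (x + conj(x)) b y. *)
apply/eqP; rewrite subr_eq addrAC eq_sym subr_eq; apply/eqP.
rewrite -!mulrDl qadd_conj -!qrealC n_xy re_xy -!mulrA.
by rewrite -mulrDr [_ + y * y]addrC qsqr_norm2 qrealC.
Qed.

Lemma twistedMl x y e : twisted x y e -> twisted x y (x * e).
Proof.
by move=> te; rewrite /twisted -mulrA -te !mulrA qmulCx qmulxC.
Qed.

Lemma twisted_eval (f : {poly quat R}) x y : qclass x = qclass y ->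
  twisted x y (left_eval f x - f.[y]).
Proof.
move=> cxy; elim/poly_ind: f => [|f a IHf].
  by rewrite -[0]/(0%:P) left_evalC hornerC subrr /twisted mulr0 mul0r.
rewrite left_evalMXaddC hornerMXaddC opprD addrACA subrr addr0.
have -> : x * left_eval f x - f.[y] * y
        = x * (left_eval f x - f.[y]) + (x * f.[y] - f.[y] * y).
  by rewrite mulrBr addrA subrK.
by apply: twistedD; [apply: twistedMl | apply: twisted_sylvester].
Qed.

Lemma twisted2_eq0 x x' y e :
  x != x' -> twisted x y e -> twisted x' y e -> e = 0.
Proof.
move=> xx' t t'; apply: (quat_mul_eq0l (qconj x - qconj x')).
  by rewrite subr_eq0 (inj_eq qconj_inj).
by rewrite mulrBl t t' subrr.
Qed.

Lemma twisted2r_eq0 x y y' e :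
  y != y' -> twisted x y e -> twisted x y' e -> e = 0.
Proof.
move=> yy' t t'; apply: (quat_mul_eq0r _ (y - y')); first by rewrite subr_eq0.
by rewrite mulrBr -t -t' subrr.
Qed.

(** * Interpolation at two nodes *)

Lemma left_interp2 x x' e e' : x != x' ->
  exists f : {poly quat R}, left_eval f x = e /\ left_eval f x' = e'.
Proof.
rewrite -subr_eq0 -qunitE => u; pose p := (x - x')^-1 * (e - e').
exists (p%:P * 'X + (e - x * p)%:P); rewrite !left_eval_linear; split.
  by rewrite addrC subrK.
by rewrite addrCA -[_ - _]opprB -mulrBl /p mulVKr // opprB addrC subrK.
Qed.

Lemma right_interp2 x x' e e' : x != x' ->
  exists f : {poly quat R}, f.[x] = e /\ f.[x'] = e'.
Proof.
rewrite -subr_eq0 -qunitE => u; pose p := (e - e') * (x - x')^-1.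
exists (p%:P * 'X + (e - p * x)%:P); rewrite !horner_linear; split.
  by rewrite addrC subrK.
by rewrite addrCA -[_ - _]opprB -mulrBr /p mulrVK // opprB addrC subrK.
Qed.

(** The node y being nonreal, so is the equivalent node x; this makes
a = (x - conj(x))^-1 meaningful. As a commutes with x, the choice
p = a (e - e') gives x p - p y = a x (e - e') - a conj(x) (e - e') = e - e'. *)
Lemma mixed_interp x y e e' : qclass x = qclass y ->
    (forall r, y <> qreal r) -> twisted x y (e - e') ->
  exists f : {poly quat R}, left_eval f x = e /\ f.[y] = e'.
Proof.
move=> cxy ynr te.
have u : (x - qconj x) \is a GRing.unit.
  rewrite qunitE subr_eq0; apply/eqP => /esym/qconj_eq_real xr.
  have := qclass_qequiv _ _ (esym cxy).
  case=> h h0; rewrite xr qrealC -mulrA.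
  by rewrite mulVr ?qunitE // mulr1; apply: ynr.
pose a := (x - qconj x)^-1; pose p := a * (e - e').
have comm_a : x * a = a * x.
  have : GRing.comm x (x - qconj x).
    by apply: commrB => //; rewrite /GRing.comm qmulxC qmulCx.
  by move/commrV.
exists (p%:P * 'X + (e - x * p)%:P).
rewrite left_eval_linear horner_linear; split; first by rewrite addrC subrK.
have -> : p * y = a * qconj x * (e - e') by rewrite /p -!mulrA te.
rewrite addrCA /p mulrA comm_a -mulrBl -[in X in _ + X]mulrBr.
rewrite -[_ - x]opprB mulrN mulVr //.
by rewrite mulN1r opprB addrC subrK.
Qed.

(** * Real polynomials separating the classes *)

Definition rpoly (l : {poly R}) : {poly quat R} := map_poly (@qreal R) l.

Lemma rpolyM (l l' : {poly R}) : rpoly (l * l') = rpoly l * rpoly l'.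
Proof. exact: rmorphM. Qed.

Lemma comm_rpoly (l : {poly R}) x : comm_poly (rpoly l) x.
Proof.
elim/poly_ind: l => [|l r IHl].
  by rewrite /rpoly rmorph0; apply: comm_poly0.
rewrite /rpoly rmorphD rmorphM /= map_polyX map_polyC; apply: comm_polyD.
  by apply: comm_polyM => //; apply: comm_polyX.
by rewrite /comm_poly hornerC qrealC.
Qed.

Lemma horner_rpolyM (f : {poly quat R}) l x :
  (f * rpoly l).[x] = f.[x] * (rpoly l).[x].
Proof. exact/hornerM_comm/comm_rpoly. Qed.

Lemma left_eval_rpolyM (f : {poly quat R}) l x :
  left_eval (f * rpoly l) x = (rpoly l).[x] * left_eval f x.
Proof.
elim/poly_ind: l => [|l r IHl].
  by rewrite /rpoly rmorph0 mulr0 -[0]/(0%:P) left_evalC hornerC mul0r.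
rewrite /rpoly rmorphD rmorphM /= map_polyX map_polyC -/(rpoly l).
rewrite mulrDr mulrA left_evalD left_evalMX left_evalMC IHl.
by rewrite hornerMXaddC mulrDl -qrealC mulrA comm_rpoly.
Qed.

Definition qchar y : {poly R} := ('X - (qre y *+ 2)%:P) * 'X + (qnorm2 y)%:P.

Lemma horner_qchar y x :
  (rpoly (qchar y)).[x] = x * x - x * qreal (qre y *+ 2) + qreal (qnorm2 y).
Proof.
rewrite /rpoly /qchar rmorphD rmorphM /= rmorphB /= map_polyX !map_polyC /=.
by rewrite hornerMXaddC hornerD hornerN hornerX hornerC /= mulrBl qrealC.
Qed.

Lemma qchar_root y x : qclass x = qclass y -> (rpoly (qchar y)).[x] = 0.
Proof.
case=> re_xy n_xy.
by rewrite horner_qchar -re_xy -n_xy addrAC qsqr_norm2 subrr.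
Qed.

(** Subtracting x^2 - 2 Re(x) x + |x|^2 = 0 leaves a relation
2 (Re x - Re y) x = |x|^2 - |y|^2. If Re x and Re y differed, x would be real,
and the value at x would be (x - Re y)^2 + |Im y|^2 > 0. *)
Lemma qchar_root_qclass y x :
  (rpoly (qchar y)).[x] = 0 -> qclass x = qclass y.
Proof.
rewrite horner_qchar; case: x y => a b c d [a' b' c' d'] [] /=.
rewrite /qclass /qnorm2 /= => e1 e2 e3 e4.
have sq := (Num.Theory.sqr_ge0 b', Num.Theory.sqr_ge0 c',
            Num.Theory.sqr_ge0 d').
have aa : a = a'.
  apply/eqP; rewrite -subr_eq0; apply/eqP.
  have [//|/eqP na] := eqVneq (a - a') 0.
  have z t : (a - a') * t = 0 -> t = 0.
    by move/eqP; rewrite mulf_eq0 => /orP[/eqP|/eqP].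
  have b0 : b = 0 by apply: z; lra.
  have c0 : c = 0 by apply: z; lra.
  have d0 : d = 0 by apply: z; lra.
  subst b c d; apply/eqP; rewrite -sqrf_eq0; apply/eqP.
  have := Num.Theory.sqr_ge0 (a - a'); case: sq => -[] *; nra.
by subst a'; congr pair; lra.
Qed.

(** On the class of x, the characteristic polynomial of y takes the values
v(z) = a z + b with a and b real, and conj(v(z)) = v(conj(z)) is also a
polynomial in z there, since conj(z) = 2 Re(x) - z. As |v(z)|^2 is a constant k
of the class, nonzero because v has no root in it, the product
k^-1 v(conj(z)) qchar(y) takes the value 1 on it. *)
Lemma separate2 x y : qclass y != qclass x ->
  exists l : {poly R},
    (forall z, qclass z = qclass x -> (rpoly l).[z] = 1) /\
    (forall z, qclass z = qclass y -> (rpoly l).[z] = 0).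
Proof.
move=> yx.
pose a := qre x *+ 2 - qre y *+ 2; pose b := qnorm2 y - qnorm2 x.
pose k := b ^+ 2 + a * b * (qre x *+ 2) + a ^+ 2 * qnorm2 x.
pose v z := z * qreal a + qreal b.
have vE z : qclass z = qclass x -> (rpoly (qchar y)).[z] = v z.
  move=> zx; rewrite -[LHS]subr0 -(qchar_root _ _ zx) !horner_qchar.
  rewrite /v /a /b !rmorphB /= mulrBr.
  move: (z * z) (z * _) (qreal _) (z * _) (qreal _) => *.
  by apply: quat_ext => /=; ring.
have kE z : qclass z = qclass x -> v (qconj z) * v z = qreal k.
  move=> [re_zx n_zx]; rewrite /k -re_zx -n_zx /v; move: (a) (b) => a' b'.
  by case: z {re_zx n_zx} => *; apply: quat_ext; rewrite /qnorm2 /=; ring.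
have v0 z : qclass z = qclass x -> v z != 0.
  move=> zx; apply: contra yx => /eqP vz0.
  by rewrite -zx; apply/eqP/esym/qchar_root_qclass; rewrite vE.
have k0 : k != 0.
  apply/eqP => k0; have := kE x erefl; rewrite k0 => /quat_mul_eq0l.
  by rewrite v0 ?qclass_conj // => /(_ isT)/eqP; apply/negP/v0.
pose w : {poly R} := (- a)%:P * 'X + (b + a * (qre x *+ 2))%:P.
have wE z : qclass z = qclass x -> (rpoly w).[z] = v (qconj z).
  case=> re_zx _; rewrite /rpoly rmorphD rmorphM /= map_polyX !map_polyC /=.
  rewrite horner_linear qconj_trace /v re_zx.
  by move: (a) (b) => a' b'; case: z {re_zx} => *; apply: quat_ext => /=; ring.
exists (k^-1%:P * w * qchar y).
split=> z cz; rewrite rpolyM horner_rpolyM; last by rewrite qchar_root ?mulr0.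
rewrite rpolyM horner_rpolyM vE // wE // {1}/rpoly map_polyC hornerC.
by rewrite -mulrA kE //= -rmorphM mulVf.
Qed.

Lemma separate x (s : seq (quat R)) :
    (forall y, y \in s -> qclass y != qclass x) ->
  exists l : {poly R},
    (forall z, qclass z = qclass x -> (rpoly l).[z] = 1) /\
    (forall y z, y \in s -> qclass z = qclass y -> (rpoly l).[z] = 0).
Proof.
elim: s => [|y s IHs] sx.
  by exists 1; split=> // z _; rewrite /rpoly rmorph1 hornerC.
have [] := IHs; first by move=> u us; apply: sx; rewrite inE us orbT.
move=> l [l1 l0].
have [e [e1 e0]] := separate2 x y (sx y (mem_head y s)).
exists (l * e); split=> [z cz|u z]; rewrite rpolyM horner_rpolyM.
  by rewrite l1 // e1 // mulr1.
rewrite inE => /orP[/eqP-> cz|us cz]; first by rewrite e0 ?mulr0.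
by rewrite (l0 u) // mul0r.
Qed.

(** * Two-sided interpolation *)

Section Interpolation.
Context {n m : nat} (alpha : 'I_n -> quat R) (beta : 'I_m -> quat R).
Variables (c : 'I_n -> quat R) (d : 'I_m -> quat R).

Definition interpolates_on (P : pred (R * R)) (f : {poly quat R}) :=
  (forall i, P (qclass (alpha i)) -> left_eval f (alpha i) = c i) /\
  (forall j, P (qclass (beta j)) -> f.[beta j] = d j).

(** A solution f for the classes met so far and a solution g for a new class
are combined into f (1 - l) + g l, where l is real, equal to 1 on the new class
and to 0 on the previous ones. *)
Lemma interpolates_seq (s : seq (quat R)) :
    (forall x, exists f, interpolates_on (pred1 (qclass x)) f) ->
  exists f, interpolates_on (mem [seq qclass x | x <- s]) f.
Proof.
move=> loc; elim: s => [|x s [f [fl fr]]]; first by exists 0.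
have [xs|xs] := boolP (qclass x \in [seq qclass x | x <- s]).
  exists f; split=> i; rewrite /= inE => /orP[/eqP e|].
  - by apply: fl; rewrite /= e.
  - exact: fl.
  - by apply: fr; rewrite /= e.
  - exact: fr.
have [g [gl gr]] := loc x.
have [] := separate x s.
  by move=> y ys; apply: contra xs => /eqP <-; apply: map_f.
move=> l [l1 l0].
have r1 : rpoly (1 - l) = 1 - rpoly l by rewrite /rpoly rmorphB rmorph1.
exists (f * rpoly (1 - l) + g * rpoly l).
split=> i; rewrite /= inE => ci;
  rewrite ?left_evalD ?hornerD ?left_eval_rpolyM ?horner_rpolyM r1;
  rewrite hornerD hornerN hornerC.
- case/orP: ci => [/eqP cx|].
    by rewrite l1 // subrr mul0r add0r mul1r; apply: gl; rewrite /= cx.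
  move=> /[dup] cs /mapP[y ys cy].
  by rewrite (l0 y) // subr0 mul0r mul1r addr0; apply: fl.
- case/orP: ci => [/eqP cx|].
    by rewrite l1 // subrr mulr0 add0r mulr1; apply: gr; rewrite /= cx.
  move=> /[dup] cs /mapP[y ys cy].
  by rewrite (l0 y) // subr0 mulr0 mulr1 addr0; apply: fr.
Qed.

(** If the class contains two left nodes (or two right nodes), they determine
a linear polynomial, and the compatibility relations at these two nodes show
that it takes the right values on the other side. Otherwise there is at most
one condition on each side. *)
Lemma interpolates_class k :
    injective alpha -> injective beta ->
    (forall j r, beta j <> qreal r) ->
    (forall i j, qclass (alpha i) = qclass (beta j) ->
      twisted (alpha i) (beta j) (c i - d j)) ->
    (forall x y z, x \in codom alpha ++ codom beta ->
      y \in codom alpha ++ codom beta -> z \in codom alpha ++ codom beta ->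
      qclass x = qclass y -> qclass y = qclass z -> x != y ->
      (z == x) || (z == y)) ->
  exists f, interpolates_on (pred1 k) f.
Proof.
move=> alpha_inj beta_inj beta_nonreal compat no_three.
have al i : alpha i \in codom alpha ++ codom beta by rewrite mem_cat codom_f.
have be j : beta j \in codom alpha ++ codom beta.
  by rewrite mem_cat codom_f orbT.
have right_residue f i j : qclass (alpha i) = qclass (beta j) ->
    left_eval f (alpha i) = c i ->
    twisted (alpha i) (beta j) (f.[beta j] - d j).
  move=> cij fi; have := twisted_eval f _ _ cij.
  rewrite fi => /(twistedB _ _ _ _ (compat _ _ cij)).
  by rewrite opprB addrC addrA subrK.
have left_residue f i j : qclass (alpha i) = qclass (beta j) ->
    f.[beta j] = d j ->
    twisted (alpha i) (beta j) (left_eval f (alpha i) - c i).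
  move=> cij fj; have := twisted_eval f _ _ cij.
  rewrite fj => /twistedB /(_ (compat _ _ cij)).
  by rewrite opprB addrA subrK.
have two_alphas i1 i2 : qclass (alpha i1) = k -> qclass (alpha i2) = k ->
    i2 != i1 -> exists f, interpolates_on (pred1 k) f.
  move=> ki1 ki2 i21.
  have a12 : alpha i1 != alpha i2 by rewrite (inj_eq alpha_inj) eq_sym.
  have [f [f1 f2]] := left_interp2 _ _ (c i1) (c i2) a12.
  exists f; split=> [i|j] /= /eqP k_.
    have := no_three _ _ _ (al i1) (al i2) (al i).
    rewrite ki1 ki2 k_ a12 !(inj_eq alpha_inj).
    by move=> /(_ erefl erefl isT)/orP[]/eqP->.
  apply/subr0_eq/(twisted2_eq0 _ _ (beta j) _ a12);
    by apply: right_residue; rewrite ?ki1 ?ki2.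
have two_betas j1 j2 : qclass (beta j1) = k -> qclass (beta j2) = k ->
    j2 != j1 -> exists f, interpolates_on (pred1 k) f.
  move=> kj1 kj2 j21.
  have b12 : beta j1 != beta j2 by rewrite (inj_eq beta_inj) eq_sym.
  have [f [f1 f2]] := right_interp2 _ _ (d j1) (d j2) b12.
  exists f; split=> [i|j] /= /eqP k_.
    apply/subr0_eq/(twisted2r_eq0 (alpha i) _ _ _ b12);
      by apply: left_residue; rewrite ?kj1 ?kj2.
  have := no_three _ _ _ (be j1) (be j2) (be j).
  rewrite kj1 kj2 k_ b12 !(inj_eq beta_inj).
  by move=> /(_ erefl erefl isT)/orP[]/eqP->.
case: (pickP [pred i | qclass (alpha i) == k]) => [i1 /eqP ki1|noi]; last first.
  case: (pickP [pred j | qclass (beta j) == k]) => [j1 /eqP kj1|noj]; last first.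
    by exists 0; split=> [i|j] /=; [rewrite [_ == _]noi | rewrite [_ == _]noj].
  case: (pickP [pred j | (qclass (beta j) == k) && (j != j1)]).
    by move=> j2 /andP[/eqP kj2 j21]; apply: two_betas j21.
  move=> noj; exists (d j1)%:P; split=> [i|j] /=; first by rewrite [_ == _]noi.
  by rewrite hornerC => kj; have:= noj j; rewrite /= kj => /negbFE/eqP->.
case: (pickP [pred i | (qclass (alpha i) == k) && (i != i1)]).
  by move=> i2 /andP[/eqP ki2 i21]; apply: two_alphas i21.
move=> noi.
have i1E i : qclass (alpha i) = k -> i = i1.
  by move=> ki; have:= noi i; rewrite /= ki eqxx => /negbFE/eqP->.
case: (pickP [pred j | qclass (beta j) == k]) => [j1 /eqP kj1|noj]; last first.
  exists (c i1)%:P; split=> [i|j] /=; last by rewrite [_ == _]noj.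
  by rewrite left_evalC => /eqP/i1E ->.
case: (pickP [pred j | (qclass (beta j) == k) && (j != j1)]).
  by move=> j2 /andP[/eqP kj2 j21]; apply: two_betas j21.
move=> noj.
have cij : qclass (alpha i1) = qclass (beta j1) by rewrite kj1.
have [f [f1 f2]] :=
  mixed_interp _ _ _ _ cij (beta_nonreal j1) (compat _ _ cij).
exists f; split=> [i|j] /= /eqP k_; first by rewrite (i1E i).
by have:= noj j; rewrite /= k_ eqxx => /negbFE/eqP->.
Qed.

End Interpolation.
End Quaternions.

Theorem theorem4p5 (R : realType) (n m : nat)
    (alpha : 'I_n -> quat R) (beta : 'I_m -> quat R)
    (c : 'I_n -> quat R) (d : 'I_m -> quat R)
    (alpha_inj : injective alpha) (beta_inj : injective beta)
    (beta_nonreal : forall (j : 'I_m) (r : R), beta j <> qreal r)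
    (no_three_equiv : forall x y z : quat R,
        x \in codom alpha ++ codom beta ->
        y \in codom alpha ++ codom beta ->
        z \in codom alpha ++ codom beta ->
        x <> y -> y <> z -> x <> z ->
        ~ [/\ qequiv x y, qequiv y z & qequiv x z]) :
  (exists f : {poly quat R},
      (forall i : 'I_n, left_eval f (alpha i) = c i) /\
      (forall j : 'I_m, f.[beta j] = d j))
  <->
  (forall (i : 'I_n) (j : 'I_m), qequiv (alpha i) (beta j) ->
      qconj (alpha i) * (c i - d j) = (c i - d j) * beta j).
Proof.
split=> [[f [fl fr]] i j /qequiv_qclass cij|compat].
  by rewrite -fl -fr; apply: twisted_eval.
have [|f [fl fr]] :=
    interpolates_seq alpha beta c d (codom alpha ++ codom beta).
  move=> x; apply: interpolates_class => //.
  - by move=> i j /qclass_qequiv; apply: compat.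
  - move=> u v w us vs ws cuv cvw /eqP uv; apply/norP => -[/eqP wu /eqP wv].
    apply: (no_three_equiv u v w) => //; do ?exact: nesym.
    by split; apply: qclass_qequiv => //; rewrite cuv.
exists f; split=> [i|j].
  by apply: fl; apply: map_f; rewrite mem_cat codom_f.
by apply: fr; apply: map_f; rewrite mem_cat codom_f orbT.
Qed.
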